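(* Let $\{\mathbb{X}_n\}_{n\in\mathbb{N}}$ be a sequence of non-trivial normed linear spaces over $\mathbb{K}$. Let $p\in(1,\infty)$ and let $q$ be its conjugate exponent, $\frac1p+\frac1q=1$. Then for any non-zero $x=\{x_n\}_{n\in\mathbb{N}}\in\bigoplus_p\mathbb{X}_n$ and any $f=\{f_n\}_{n\in\mathbb{N}}\in\bigoplus_q\mathbb{X}_n^*$, one has $f\in J(x)$ if and only if, for every $n\in\mathbb{N}$, $$\frac{\|x\|_p^{p-1}}{\|x_n\|^{p-1}}f_n\in J(x_n)\quad\text{if }x_n\neq0,\qquad\text{and}\qquad f_n=0\quad\text{if }x_n=0.$$
   Context: $\mathbb{K}=\mathbb{R}$ or $\mathbb{C}$; $\mathbb{X}^*$ is the continuous dual of a normed space $\mathbb{X}$; non-trivial means of dimension more than $0$. For $1\le p<\infty$, $\bigoplus_p\mathbb{X}_n$ is the space of sequences $\{x_n\}$ with $x_n\in\mathbb{X}_n$ and $\sum_n\|x_n\|^p<\infty$, with norm $\|\{x_n\}\|_p=(\sum_n\|x_n\|^p)^{1/p}$. The dual of $\bigoplus_p\mathbb{X}_n$ is identified isometrically with $\bigoplus_q\mathbb{X}_n^*$ via $f(x)=\sum_n f_n(x_n)$. For a non-zero $x$ in a normed space $\mathbb{X}$, $J(x)$ is the set of support functionals of $x$, i.e. of all $f\in\mathbb{X}^*$ with $\|f\|=1$ and $f(x)=\|x\|$. *)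

(* Defs.v *)
From HB Require Import structures.
From mathcomp Require Import all_boot all_order all_algebra.
From mathcomp Require Import complex.
From mathcomp Require Import all_classical all_reals all_analysis.

Set Implicit Arguments.
Unset Strict Implicit.
Unset Printing Implicit Defensive.
Import Order.TTheory GRing.Theory Num.Theory.
Import numFieldNormedType.Exports.
Local Open Scope classical_set_scope.
Local Open Scope ring_scope.

Variant scalar_kind := RealScalars | ComplexScalars.

Definition scalars (R : realType) (k : scalar_kind) : numFieldType :=
  match k with RealScalars => R | ComplexScalars => R[i] end.

(* A norm on a K-module takes its values in K itself; [of_real] embeds R into K
   and [to_real] is its left inverse (the real part), so that real powers,
   suprema and extended sums of norms can be formed in R. *)
Definition of_real (R : realType) (k : scalar_kind) : R -> scalars R k :=
  match k with RealScalars => fun r => r | ComplexScalars => fun r => r%:C%C end.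

Definition to_real (R : realType) (k : scalar_kind) : scalars R k -> R :=
  match k with RealScalars => fun z => z | ComplexScalars => fun z => complex.Re z end.

Section RealNorm.
Context {R : realType} {k : scalar_kind}.
Local Notation K := (scalars R k).
Local Notation of_real := (@of_real R k).
Local Notation to_real := (@to_real R k).

Lemma of_realK : cancel of_real to_real.
Proof. by rewrite /of_real /to_real; case: (k). Qed.

Lemma to_realK (z : K) : 0 <= z -> of_real (to_real z) = z.
Proof.
rewrite /of_real /to_real /scalars in z *; case: k z => // -[a b].
by rewrite lecE /= => /andP[/eqP -> _].
Qed.

Lemma of_real0 : of_real 0 = 0.
Proof. by rewrite /of_real; case: (k). Qed.

Lemma of_real1 : of_real 1 = 1.
Proof. by rewrite /of_real; case: (k). Qed.

Lemma of_realD a b : of_real (a + b) = of_real a + of_real b.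
Proof. by rewrite /of_real; case: (k) => //=; rewrite rmorphD. Qed.

Lemma of_realM a b : of_real (a * b) = of_real a * of_real b.
Proof. by rewrite /of_real; case: (k) => //=; rewrite rmorphM. Qed.

Lemma ler_of_real a b : (of_real a <= of_real b) = (a <= b).
Proof. by rewrite /of_real; case: (k) => //=; rewrite lecR. Qed.

Lemma ltr_of_real a b : (of_real a < of_real b) = (a < b).
Proof. by rewrite /of_real; case: (k) => //=; rewrite ltcR. Qed.

Definition rnorm (V : normedZmodType K) (v : V) : R := to_real `|v|.

Lemma of_real_rnorm (V : normedZmodType K) (v : V) :
  of_real (rnorm v) = `|v|.
Proof. exact: to_realK. Qed.

Lemma rnorm_ge0 (V : normedZmodType K) (v : V) : 0 <= rnorm v.
Proof. by rewrite -ler_of_real of_real0 of_real_rnorm. Qed.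

Lemma ler_rnormD (V : normedZmodType K) (v w : V) :
  rnorm (v + w) <= rnorm v + rnorm w.
Proof. by rewrite -ler_of_real of_realD !of_real_rnorm ler_normD. Qed.

Lemma rnormM (a b : K) : rnorm (a * b) = rnorm a * rnorm b.
Proof.
by apply: (can_inj of_realK); rewrite of_realM !of_real_rnorm normrM.
Qed.

Lemma rnormZ (V : normedModType K) (a : K) (v : V) :
  rnorm (a *: v) = rnorm a * rnorm v.
Proof.
by apply: (can_inj of_realK); rewrite of_realM !of_real_rnorm normrZ.
Qed.

Lemma rnormN (V : normedZmodType K) (v : V) : rnorm (- v) = rnorm v.
Proof. by rewrite /rnorm normrN. Qed.

Lemma rnorm0 (V : normedZmodType K) : rnorm (0 : V) = 0.
Proof. by apply: (can_inj of_realK); rewrite of_real_rnorm normr0 [RHS]of_real0. Qed.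

Lemma rnorm_eq0 (V : normedZmodType K) (v : V) : rnorm v = 0 -> v = 0.
Proof.
by move=> v0; apply/eqP; rewrite -normr_eq0 -of_real_rnorm v0 of_real0.
Qed.

Lemma rnorm_of_real a : rnorm (of_real a) = `|a|.
Proof.
apply: (can_inj of_realK); rewrite of_real_rnorm.
have h b : 0 <= b -> `|of_real b| = of_real b.
  by move=> b0; apply: ger0_norm; rewrite -of_real0 ler_of_real.
case: (leP 0 a) => a0; first by rewrite h// [in RHS]ger0_norm.
rewrite [in RHS]ltr0_norm// -(h (- a)) ?oppr_ge0 ?(ltW a0)// -normrN; congr `|_|.
by apply/eqP; rewrite eq_sym -subr_eq0 opprK -of_realD addNr of_real0.
Qed.

End RealNorm.


Section Dual.
Context {R : realType} {k : scalar_kind}.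
Local Notation K := (scalars R k).

Record dual (X : normedModType K) := Dual {
  dual_fun :> X -> K;
  dual_linear : scalar dual_fun;
  dual_continuous : continuous dual_fun }.

HB.instance Definition _ (X : normedModType K) (f : dual X) :=
  GRing.isLinear.Build K X K *%R (dual_fun f) (@dual_linear X f).

HB.instance Definition _ (X : normedModType K) := gen_eqMixin (dual X).
HB.instance Definition _ (X : normedModType K) := gen_choiceMixin (dual X).

Variable X : normedModType K.
Implicit Types (f g h : dual X) (a : K).

Lemma dualP f g : (forall x, f x = g x) -> f = g.
Proof.
case: f g => [f fl fc] [g gl gc] /= /funext fg.
by subst g; congr Dual; exact: Prop_irrelevance.
Qed.

Let regular_of (h : X -> K) (hl : scalar h) : {linear X -> K^o} :=
  HB.pack_for {linear X -> K^o} (h : X -> K^o)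
    (GRing.isLinear.Build K X K^o *:%R h hl).

Lemma dual_bound f :
  exists2 M : R, 0 <= M & forall x, rnorm (f x) <= M * rnorm x.
Proof.
have /linear_boundedP/pinfty_ex_gt0[M M0 HM] :
    bounded_near (regular_of (@dual_linear X f)) (nbhs (0 : X)).
  exact/linear_bounded_continuous/(@dual_continuous X f).
exists (to_real M).
  by rewrite -(@ler_of_real R k) of_real0 to_realK ltW.
move=> x; rewrite -(@ler_of_real R k) of_realM to_realK ?(ltW M0)//.
by rewrite !of_real_rnorm; exact: HM.
Qed.

Lemma bounded_dual_continuous (f : X -> K) (M : R) : scalar f ->
  (forall x, rnorm (f x) <= M * rnorm x) -> continuous f.
Proof.
move=> fl fM.
apply: (@linear_bounded_continuous _ _ _ (regular_of fl)).1.
apply/linear_boundedP; exists (of_real k M); split.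
  rewrite realE.
  by case: (leP 0 M) => M0; rewrite -(@of_real0 R k) !ler_of_real ?M0 ?(ltW M0) ?orbT.
move=> y My x; rewrite -!of_real_rnorm.
apply: (@le_trans _ _ (of_real k (M * rnorm x))); first by rewrite ler_of_real.
by rewrite of_realM ler_wpM2r ?(ltW My)// of_real_rnorm.
Qed.

Definition opnorm (f : X -> K) : R :=
  sup [set rnorm (f x) | x in [set x | rnorm x <= 1]].

Lemma opnorm_has_sup f :
  has_sup [set rnorm (f x) | x in [set x | rnorm x <= 1]].
Proof.
split; first by exists (rnorm (f 0)), 0 => //=; rewrite rnorm0.
have [M M0 HM] := dual_bound f; exists M => _ [x /= x1 <-].
by rewrite (le_trans (HM x))// ler_piMr.
Qed.

Lemma opnorm_le f (M : R) :
  (forall x, rnorm x <= 1 -> rnorm (f x) <= M) -> opnorm f <= M.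
Proof.
move=> HM; apply: ge_sup; first by have [] := opnorm_has_sup f.
by move=> _ [x /= x1 <-]; exact: HM.
Qed.

Lemma opnorm_ge f x : rnorm x <= 1 -> rnorm (f x) <= opnorm f.
Proof.
by move=> x1; apply: ub_le_sup; [have [] := opnorm_has_sup f | exists x].
Qed.

Lemma opnorm_ge0 f : 0 <= opnorm f.
Proof. by apply: le_trans (opnorm_ge f (x := 0) _); rewrite ?rnorm_ge0 ?rnorm0. Qed.

Lemma opnormP f x : rnorm (f x) <= opnorm f * rnorm x.
Proof.
have [->|x0] := eqVneq x 0; first by rewrite linear0 !rnorm0 mulr0.
have nx0 : 0 < rnorm x.
  by rewrite lt_neqAle rnorm_ge0 andbT; apply/eqP => /esym/rnorm_eq0/eqP; exact/negP.
have := @opnorm_ge f (of_real k (rnorm x)^-1 *: x).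
rewrite linearZ /= rnormM rnormZ rnorm_of_real ger0_norm ?invr_ge0 ?rnorm_ge0//.
by rewrite mulVf ?gt_eqF// => /(_ (lexx _)); rewrite ler_pdivrMl// mulrC.
Qed.

Definition dual_mk (f : X -> K) (M : R) (fl : scalar f)
  (fM : forall x, rnorm (f x) <= M * rnorm x) : dual X :=
  Dual fl (bounded_dual_continuous fl fM).

Let zero_linear : scalar (fun _ : X => 0 : K).
Proof. by move=> a x y /=; rewrite mulr0 addr0. Qed.
Let zero_bound (x : X) : rnorm (0 : K) <= 0 * rnorm x.
Proof. by rewrite rnorm0 mul0r. Qed.
Definition dual_zero := dual_mk zero_linear zero_bound.

Let add_linear f g : scalar (fun x => f x + g x).
Proof. by move=> a x y; rewrite !dual_linear mulrDr addrACA. Qed.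
Let add_bound f g x : rnorm (f x + g x) <= (opnorm f + opnorm g) * rnorm x.
Proof. by rewrite (le_trans (ler_rnormD _ _))// mulrDl lerD ?opnormP. Qed.
Definition dual_add f g := dual_mk (@add_linear f g) (@add_bound f g).

Let scale_linear a f : scalar (fun x => a * f x).
Proof. by move=> b x y; rewrite dual_linear mulrDr mulrCA. Qed.
Let scale_bound a f x : rnorm (a * f x) <= (rnorm a * opnorm f) * rnorm x.
Proof. by rewrite rnormM -mulrA ler_wpM2l ?rnorm_ge0 ?opnormP. Qed.
Definition dual_scale a f := dual_mk (@scale_linear a f) (@scale_bound a f).

Let addA : associative dual_add.
Proof. by move=> f g h; apply: dualP => x /=; rewrite addrA. Qed.
Let addC : commutative dual_add.
Proof. by move=> f g; apply: dualP => x /=; rewrite addrC. Qed.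
Let add0 : left_id dual_zero dual_add.
Proof. by move=> f; apply: dualP => x /=; rewrite add0r. Qed.
Let addN : left_inverse dual_zero (dual_scale (-1)) dual_add.
Proof. by move=> f; apply: dualP => x /=; rewrite mulN1r addNr. Qed.
HB.instance Definition _ := GRing.isZmodule.Build (dual X) addA addC add0 addN.

Let scaleA a b f : dual_scale a (dual_scale b f) = dual_scale (a * b) f.
Proof. by apply: dualP => x /=; rewrite mulrA. Qed.
Let scale1 : left_id 1 dual_scale.
Proof. by move=> f; apply: dualP => x /=; rewrite mul1r. Qed.
Let scaleDr : right_distributive dual_scale +%R.
Proof. by move=> a f g; apply: dualP => x /=; rewrite mulrDr. Qed.
Let scaleDl f : {morph dual_scale^~ f : a b / a + b}.
Proof. by move=> a b; apply: dualP => x /=; rewrite mulrDl. Qed.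
HB.instance Definition _ :=
  GRing.Zmodule_isLmodule.Build K (dual X) scaleA scale1 scaleDr scaleDl.

Let normD f g :
  of_real k (opnorm (f + g)) <= of_real k (opnorm f) + of_real k (opnorm g).
Proof.
rewrite -of_realD ler_of_real; apply: opnorm_le => x x1.
by rewrite (le_trans (ler_rnormD _ _))// lerD ?opnorm_ge.
Qed.

Let opnormZ_le a f : opnorm (a *: f) <= rnorm a * opnorm f.
Proof.
by apply: opnorm_le => x x1; rewrite rnormM ler_wpM2l ?rnorm_ge0 ?opnorm_ge.
Qed.

Let normZ a f : of_real k (opnorm (a *: f)) = `|a| * of_real k (opnorm f).
Proof.
rewrite -of_real_rnorm -of_realM; congr of_real; apply/eqP.
rewrite eq_le opnormZ_le andTb.
have [->|a0] := eqVneq a 0; first by rewrite rnorm0 mul0r opnorm_ge0.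
have na : rnorm a * rnorm a^-1 = 1.
  rewrite -rnormM mulfV //; apply: (can_inj (@of_realK R k)).
  by rewrite of_real_rnorm normr1 of_real1.
have := opnormZ_le a^-1 (a *: f); rewrite scalerA mulVf // scale1r.
move=> /(ler_wpM2l (rnorm_ge0 a)) /le_trans; apply.
by rewrite mulrA na mul1r.
Qed.

Let norm_eq0 f : of_real k (opnorm f) = 0 -> f = 0.
Proof.
rewrite -(@of_real0 R k) => /(can_inj (@of_realK R k)) f0.
apply: dualP => x; apply: rnorm_eq0; apply/eqP.
by rewrite eq_le rnorm_ge0 andbT (le_trans (opnormP _ _))// f0 mul0r.
Qed.

HB.instance Definition _ := Lmodule_isNormed.Build K (dual X) normD normZ norm_eq0.

Lemma rnorm_dual f : rnorm f = opnorm f.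
Proof. exact: of_realK. Qed.

End Dual.

Definition support_functionals (R : realType) (k : scalar_kind)
    (X : normedModType (scalars R k)) (x : X) : set (dual X) :=
  [set f : dual X | `|f| = 1 /\ f x = `|x|].

Section PSum.
Context {R : realType}.
Implicit Types (p q : R) (u v : R^nat).
Local Open Scope ereal_scope.

Lemma psum_ge0 p u : 0 <= \sum_(n <oo) (u n `^ p)%:E.
Proof. by apply: nneseries_ge0 => n _ _; rewrite lee_fin powR_ge0. Qed.

Lemma psum_fin p u : \sum_(n <oo) (u n `^ p)%:E < +oo ->
  \sum_(n <oo) (u n `^ p)%:E = (fine (\sum_(n <oo) (u n `^ p)%:E))%:E.
Proof. by move=> h; rewrite fineK// ge0_fin_numE// psum_ge0. Qed.

Lemma psum_Lnorm p u : (0 < p)%R -> (forall n, 0 <= u n)%R ->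
  Lnorm counting p%:E (EFin \o u) = (\sum_(n <oo) (u n `^ p)%:E) `^ p^-1.
Proof.
move=> p0 u0; rewrite Lnorm_counting//; congr (_ `^ _).
by apply: eq_eseriesr => n _; rewrite /= ger0_norm.
Qed.

Lemma psumD p u v : (1 <= p)%R -> (forall n, 0 <= u n)%R -> (forall n, 0 <= v n)%R ->
    \sum_(n <oo) (u n `^ p)%:E < +oo -> \sum_(n <oo) (v n `^ p)%:E < +oo ->
  \sum_(n <oo) ((u n + v n) `^ p)%:E < +oo /\
  (fine (\sum_(n <oo) ((u n + v n) `^ p)%:E) `^ p^-1 <=
   fine (\sum_(n <oo) (u n `^ p)%:E) `^ p^-1 +
   fine (\sum_(n <oo) (v n `^ p)%:E) `^ p^-1)%R.
Proof.
move=> p1 u0 v0 uoo voo; have p0 : (0 < p)%R by exact: lt_le_trans p1.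
have w0 n : (0 <= (u \+ v) n)%R by rewrite addr_ge0.
have := @minkowski_EFin _ _ R counting u v p (fun _ _ _ => I) (fun _ _ _ => I) p1.
rewrite !psum_Lnorm// (psum_fin uoo) (psum_fin voo) !poweR_EFin -EFinD => H.
have woo : \sum_(n <oo) ((u n + v n) `^ p)%:E < +oo.
  rewrite ltNge leye_eq; apply/negP => /eqP woo.
  by move: H; rewrite woo poweRyr ?invr_neq0 ?gt_eqF// leye_eq.
by split=> //; move: H; rewrite /= psum_fin// poweR_EFin lee_fin.
Qed.

Lemma le_psum p u v : (0 <= p)%R -> (forall n, 0 <= u n)%R -> (forall n, u n <= v n)%R ->
  \sum_(n <oo) (u n `^ p)%:E <= \sum_(n <oo) (v n `^ p)%:E.
Proof.
move=> p0 u0 uv; apply: lee_nneseries => n *; rewrite lee_fin ?powR_ge0//.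
by rewrite ge0_ler_powR// nnegrE (le_trans (u0 n)).
Qed.

Lemma psumZ p (a : R) u : (0 <= a)%R -> (forall n, 0 <= u n)%R ->
  \sum_(n <oo) ((a * u n) `^ p)%:E = (a `^ p)%:E * \sum_(n <oo) (u n `^ p)%:E.
Proof.
move=> a0 u0; rewrite -nneseriesZl; last by move=> *; rewrite lee_fin powR_ge0.
by apply: eq_eseriesr => n _; rewrite powRM.
Qed.

Lemma psum_hoelder p q u v : (0 < p)%R -> (0 < q)%R -> (p^-1 + q^-1 = 1)%R ->
    (forall n, 0 <= u n)%R -> (forall n, 0 <= v n)%R ->
    \sum_(n <oo) (u n `^ p)%:E < +oo -> \sum_(n <oo) (v n `^ q)%:E < +oo ->
  \sum_(n <oo) (u n * v n)%:E <=
  (fine (\sum_(n <oo) (u n `^ p)%:E) `^ p^-1 *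
   fine (\sum_(n <oo) (v n `^ q)%:E) `^ q^-1)%:E.
Proof.
move=> p0 q0 pq u0 v0 uoo voo; have w0 n : (0 <= (u \* v) n)%R by rewrite mulr_ge0.
have := @hoelder _ _ R counting u v p q (fun _ _ _ => I) (fun _ _ _ => I) p0 q0 pq.
rewrite !psum_Lnorm// (psum_fin uoo) (psum_fin voo) !poweR_EFin -EFinM invr1.
rewrite poweRe1 ?psum_ge0//; apply: le_trans.
by rewrite le_eqVlt; apply/orP; left; apply/eqP/eq_eseriesr => n _; rewrite powRr1.
Qed.

End PSum.

Section ScalarSeries.
Context {R : realType} {k : scalar_kind}.
Local Notation K := (scalars R k).

Lemma scalars_abs_cvg (u : nat -> K) :
  (\sum_(n <oo) (rnorm (u n))%:E < +oo)%E -> cvgn (series u).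
Proof.
rewrite /rnorm /to_real /scalars in u *; case: k u => u uoo.
  apply: (@normed_cvg R R u); apply: nnseries_is_cvg; last exact: uoo.
  by move=> i; exact: normr_ge0.
have reim_le (z : R[i]) : `|complex.Re z| <= complex.Re `|z| /\ `|complex.Im z| <= complex.Re `|z|.
  case: z => a b /=; rewrite -!sqrtr_sqr !ler_wsqrtr// ?lerDl ?lerDr ?sqr_ge0//.
have cvgp (g : R[i] -> R) : (forall z, `|g z| <= complex.Re `|z|) ->
    cvgn (series (g \o u : R^nat)).
  move=> gle; apply: (@normed_cvg R R); apply: nnseries_is_cvg.
    by move=> i; exact: normr_ge0.
  apply: (le_lt_trans _ uoo); apply: lee_nneseries => n *; rewrite lee_fin.
    exact: normr_ge0.
  exact: gle.
have /cvg_ex[a ca] := cvgp _ (fun z => (reim_le z).1).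
have /cvg_ex[b cb] := cvgp _ (fun z => (reim_le z).2).
apply/cvg_ex; exists (Complex a b).
apply/cvgrPdist_lt => -[e e']; rewrite ltcE /= => /andP[/eqP -> e0].
have e2 : 0 < e / 2 by rewrite divr_gt0.
move/cvgrPdist_lt: ca => /(_ _ e2) ca; move/cvgrPdist_lt: cb => /(_ _ e2) cb.
near=> n.
have -> : series u n = Complex (series (@complex.Re R \o u) n) (series (@complex.Im R \o u) n).
  rewrite /series /=; elim/big_rec3: _ => // i x y z _ ->.
  by case: (u i).
have ltRe : forall c d : R, `|Complex c d| <= (`|c| + `|d|)%:C%C.
  move=> c d; have -> : Complex c d = c%:C%C + 'i%C * d%:C%C.
    by apply/eqP; rewrite eq_complex /= !(mul0r, mul1r, subr0, addr0, add0r, mulr0) !eqxx.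
  rewrite (le_trans (ler_normD _ _))// normrM rmorphD /= lerD//.
    by rewrite normc_def /= expr0n /= addr0 sqrtr_sqr.
  by rewrite !normc_def /= !expr0n /= !addr0 add0r expr1n sqrtr1 mul1r sqrtr_sqr.
apply: le_lt_trans (ltRe _ _) _; rewrite ltcR (splitr e) ltrD//; near: n => //.
Unshelve. all: by end_near. Qed.

Lemma scalars_series_le (u : nat -> K) :
  (\sum_(n <oo) (rnorm (u n))%:E < +oo)%E ->
  rnorm (limn (series u)) <= fine (\sum_(n <oo) (rnorm (u n))%:E)%E.
Proof.
move=> uoo; have /cvgrPdist_lt cu := scalars_abs_cvg uoo.
apply/ler_addgt0Pr => e e0.
have ek : 0 < of_real k e by rewrite -(@of_real0 R k) ltr_of_real.
have [N _ /(_ N (leqnn N))] := cu _ ek.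
rewrite /= -of_real_rnorm ltr_of_real => uN.
rewrite -[limn _](subrK (series u N)) (le_trans (ler_rnormD _ _))// addrC.
rewrite lerD ?(ltW uN)//.
have h0 : forall n, (0 <= (rnorm (u n))%:E)%E by move=> n; rewrite lee_fin rnorm_ge0.
rewrite -lee_fin fineK; last by rewrite ge0_fin_numE// nneseries_ge0.
apply: le_trans (nneseries_lim_ge N _) => //.
rewrite sumEFin lee_fin /series /= big_mkord [leRHS]big_mkord.
elim/big_rec2: _ => [|i x y _ h]; first by rewrite rnorm0.
by rewrite (le_trans (ler_rnormD _ _))// lerD2l.
Qed.

End ScalarSeries.

Section LpSum.
Context {R : realType} {k : scalar_kind}.
Local Notation K := (scalars R k).

(* The proof of 1 <= p is a parameter of the type only so that the norm
   instance below, which needs Minkowski's inequality, can be attached to it. *)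
Record lpsum (p : R) (p1 : 1 <= p) (X : nat -> normedModType K) := LpSum {
  lpsum_val :> forall n, X n;
  lpsumP : (\sum_(n <oo) (rnorm (lpsum_val n) `^ p)%:E < +oo)%E }.

HB.instance Definition _ (p : R) (p1 : 1 <= p) (X : nat -> normedModType K) :=
  gen_eqMixin (lpsum p1 X).
HB.instance Definition _ (p : R) (p1 : 1 <= p) (X : nat -> normedModType K) :=
  gen_choiceMixin (lpsum p1 X).

Variables (p : R) (p1 : 1 <= p) (X : nat -> normedModType K).
Local Notation E := (lpsum p1 X).
Implicit Types (x y z : E) (a : K).

Lemma lpsum_eq x y : (forall n, x n = y n) -> x = y.
Proof.
case: x y => [x xP] [y yP] /= xy0.
have xy := functional_extensionality_dep xy0; move: xy0 => _.
by subst y; congr LpSum; exact: Prop_irrelevance.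
Qed.

Let p0 : 0 < p. Proof. exact: lt_le_trans p1. Qed.

Let zeroP : (\sum_(n <oo) (rnorm (0 : X n) `^ p)%:E < +oo)%E.
Proof. by rewrite eseries0// => n _ _; rewrite rnorm0 powR0// gt_eqF. Qed.
Definition lpsum_zero : E := LpSum p1 zeroP.

Let psum_add x y := psumD p1 (fun n => rnorm_ge0 (x n)) (fun n => rnorm_ge0 (y n))
  (lpsumP x) (lpsumP y).

Let le_add x y : (\sum_(n <oo) (rnorm (x n + y n) `^ p)%:E <=
  \sum_(n <oo) ((rnorm (x n) + rnorm (y n)) `^ p)%:E)%E.
Proof. by apply: le_psum => [|n|n]; rewrite ?rnorm_ge0 ?ler_rnormD ?ltW. Qed.

Let addP x y : (\sum_(n <oo) (rnorm (x n + y n) `^ p)%:E < +oo)%E.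
Proof. exact: (le_lt_trans (le_add x y) (psum_add x y).1). Qed.
Definition lpsum_add x y : E := LpSum p1 (addP x y).

Let psum_scale a x : (\sum_(n <oo) (rnorm (a *: x n) `^ p)%:E =
  (rnorm a `^ p)%:E * \sum_(n <oo) (rnorm (x n) `^ p)%:E)%E.
Proof.
rewrite -psumZ ?rnorm_ge0// => [|n]; last exact: rnorm_ge0.
by apply: eq_eseriesr => n _; rewrite rnormZ.
Qed.

Let scaleP a x : (\sum_(n <oo) (rnorm (a *: x n) `^ p)%:E < +oo)%E.
Proof. by rewrite psum_scale (psum_fin (lpsumP x)) -EFinM ltry. Qed.
Definition lpsum_scale a x : E := LpSum p1 (scaleP a x).

Let addA : associative lpsum_add.
Proof. by move=> x y z; apply: lpsum_eq => n /=; rewrite addrA. Qed.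
Let addC : commutative lpsum_add.
Proof. by move=> x y; apply: lpsum_eq => n /=; rewrite addrC. Qed.
Let add0 : left_id lpsum_zero lpsum_add.
Proof. by move=> x; apply: lpsum_eq => n /=; rewrite add0r. Qed.
Let addN : left_inverse lpsum_zero (lpsum_scale (-1)) lpsum_add.
Proof. by move=> x; apply: lpsum_eq => n /=; rewrite scaleN1r addNr. Qed.
HB.instance Definition _ := GRing.isZmodule.Build E addA addC add0 addN.

Let scaleA a b x : lpsum_scale a (lpsum_scale b x) = lpsum_scale (a * b) x.
Proof. by apply: lpsum_eq => n /=; rewrite scalerA. Qed.
Let scale1 : left_id 1 lpsum_scale.
Proof. by move=> x; apply: lpsum_eq => n /=; rewrite scale1r. Qed.
Let scaleDr : right_distributive lpsum_scale +%R.
Proof. by move=> a x y; apply: lpsum_eq => n /=; rewrite scalerDr. Qed.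
Let scaleDl x : {morph lpsum_scale^~ x : a b / a + b}.
Proof. by move=> a b; apply: lpsum_eq => n /=; rewrite scalerDl. Qed.
HB.instance Definition _ :=
  GRing.Zmodule_isLmodule.Build K E scaleA scale1 scaleDr scaleDl.

Definition lpnorm x : R := fine (\sum_(n <oo) (rnorm (x n) `^ p)%:E)%E `^ p^-1.

Let normD x y :
  of_real k (lpnorm (x + y)) <= of_real k (lpnorm x) + of_real k (lpnorm y).
Proof.
rewrite -of_realD ler_of_real; apply: le_trans (psum_add x y).2.
apply: ge0_ler_powR; rewrite ?invr_ge0 ?(ltW p0) ?nnegrE ?fine_ge0 ?psum_ge0//.
apply: fine_le; last exact: (le_add x y).
  by rewrite ge0_fin_numE ?psum_ge0//; exact: (addP x y).
by rewrite ge0_fin_numE ?psum_ge0//; exact: (psum_add x y).1.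
Qed.

Let normZ a x : of_real k (lpnorm (a *: x)) = `|a| * of_real k (lpnorm x).
Proof.
rewrite -of_real_rnorm -of_realM; congr of_real; rewrite /lpnorm psum_scale.
rewrite (psum_fin (lpsumP x)) -EFinM /= powRM ?powR_ge0 ?fine_ge0 ?psum_ge0//.
by rewrite -powRrM mulfV ?gt_eqF// powRr1 ?rnorm_ge0.
Qed.

Let norm_eq0 x : of_real k (lpnorm x) = 0 -> x = 0.
Proof.
rewrite -(@of_real0 R k) => /(can_inj (@of_realK R k)) /powR_eq0_eq0 x0.
apply: lpsum_eq => n; apply: rnorm_eq0; apply: (@powR_eq0_eq0 _ _ p).
apply/eqP; rewrite eq_le powR_ge0 andbT -lee_fin.
have := psum_fin (lpsumP x); rewrite x0 => <-.
rewrite (nneseriesD1 (n := n))//; last by move=> i *; rewrite lee_fin powR_ge0.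
by rewrite leeDl// nneseries_ge0// => i *; rewrite lee_fin powR_ge0.
Qed.

HB.instance Definition _ := Lmodule_isNormed.Build K E normD normZ norm_eq0.

Lemma rnorm_lpsum x : rnorm x = lpnorm x.
Proof. exact: of_realK. Qed.

End LpSum.

Lemma conjugate_ge1 (R : realType) (p q : R) :
  1 < p -> p^-1 + q^-1 = 1 -> 1 <= q.
Proof.
move=> p1 pq; have p0 : 0 < p by exact: lt_trans p1.
have q'E : q^-1 = 1 - p^-1 by rewrite -pq addrC addKr.
have q'0 : 0 < q^-1 by rewrite q'E subr_gt0 invf_lt1.
rewrite -[q]invrK invf_ge1// q'E gerBl invr_ge0 ltW//.
Qed.

Section Pairing.
Context {R : realType} {k : scalar_kind}.
Local Notation K := (scalars R k).
Variables (p q : R) (p1 : 1 <= p) (q1 : 1 <= q) (pq : p^-1 + q^-1 = 1).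
Variable X : nat -> normedModType K.
Variable f : lpsum q1 (fun n => dual (X n)).

Let pairing (x : lpsum p1 X) : K := limn (series (fun n => f n (x n))).

Let pairing_sum (x : lpsum p1 X) : (\sum_(n <oo) (rnorm (f n (x n)))%:E <=
  (rnorm f * rnorm x)%:E)%E.
Proof.
have p0 : 0 < p by exact: lt_le_trans p1.
have q0 : 0 < q by exact: lt_le_trans q1.
have qp : q^-1 + p^-1 = 1 by rewrite addrC.
rewrite !rnorm_lpsum; have := psum_hoelder q0 p0 qp (fun n => rnorm_ge0 (f n)) (fun n => rnorm_ge0 (x n))
  (lpsumP f) (lpsumP x).
apply: le_trans.
apply: lee_nneseries => n *; rewrite lee_fin ?rnorm_ge0//.
by rewrite rnorm_dual opnormP.
Qed.

Let pairing_lty (x : lpsum p1 X) : (\sum_(n <oo) (rnorm (f n (x n)))%:E < +oo)%E.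
Proof. exact: le_lt_trans (pairing_sum x) (ltry _). Qed.

Let pairing_linear : scalar pairing.
Proof.
move=> a x y; rewrite /pairing.
have cx := scalars_abs_cvg (pairing_lty x).
have cy := scalars_abs_cvg (pairing_lty y).
apply/cvg_lim => //.
rewrite (_ : series _ = (fun n => a * series (fun n => f n (x n)) n
   + series (fun n => f n (y n)) n)); last first.
  apply/funext => n; rewrite /series /= mulr_sumr -big_split /=.
  by apply: eq_bigr => i _; rewrite dual_linear.
by apply: cvgD => //; apply: cvgMr.
Qed.

Let pairing_bound (x : lpsum p1 X) : rnorm (pairing x) <= rnorm f * rnorm x.
Proof.
rewrite (le_trans (scalars_series_le (pairing_lty x)))//.
rewrite -lee_fin fineK ?pairing_sum// ge0_fin_numE ?pairing_lty//.
by apply: nneseries_ge0 => n *; rewrite lee_fin rnorm_ge0.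
Qed.

(* The image of f under the identification of the l^q-sum of the duals with
   the dual of the l^p-sum. *)
Definition lpsum_functional : dual (lpsum p1 X) :=
  dual_mk pairing_linear pairing_bound.

End Pairing.

(* Main.v *)
(* If f supports x, then w |-> ||w||^p / p - ||x||^(p-1) Re f(w) attains its
   minimum at x, by Young's inequality.  Perturbing only the m-th coordinate of
   x turns this into
     ||x||^(p-1) Re f_m(h) <= (||x_m + h|| - ||x_m||) ||x_m + h||^(p-1),
   and letting t -> 0 with h = t z and h = - t x_m yields
     ||x||^(p-1) ||f_m|| <= ||x_m||^(p-1)  and
     ||x||^(p-1) f_m(x_m) = ||x_m||^p.
   So only ||F|| <= ||f||_q, and not the full isometry between the q-sum of the
   duals and the dual of the p-sum, is needed.  Conversely the coordinate
   conditions give ||f||_q = 1 and sum_n f_n(x_n) = ||x||. *)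
Require Import Defs.
From mathcomp Require Import all_boot all_order all_algebra.
From mathcomp Require Import ring lra.
From mathcomp Require complex.
From mathcomp Require Import all_classical all_reals all_analysis.
Import Order.TTheory GRing.Theory Num.Theory.
Import numFieldNormedType.Exports.
Local Open Scope ring_scope.

Set Implicit Arguments.
Unset Strict Implicit.

(** * Real parts and phases of scalars, for both scalar fields at once *)

Section RealPart.
Context {R : realType} {k : scalar_kind}.
Implicit Types (z w : scalars R k) (r : R).

Lemma rnorm_gt0 (V : normedZmodType (scalars R k)) (v : V) :
  (0 < rnorm v) = (v != 0).
Proof. by rewrite -(@ltr_of_real R k) of_real0 of_real_rnorm normr_gt0. Qed.

Lemma to_realD z w : to_real (z + w) = to_real z + to_real w.
Proof. by rewrite /to_real; case: k z w => // -[a b] [c d]. Qed.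

Lemma to_real_of_realM r z : to_real (of_real k r * z) = r * to_real z.
Proof. by rewrite /to_real; case: k z => // -[a b] /=; rewrite mul0r subr0. Qed.

Lemma to_real_le_rnorm z : to_real z <= rnorm z.
Proof.
rewrite /rnorm /to_real; case: k z => [z|[a b]] /=; first exact: ler_norm.
by rewrite (le_trans (ler_norm _))// -sqrtr_sqr ler_wsqrtr// lerDl sqr_ge0.
Qed.

(** Over the complex numbers, a^2 + b^2 = a^2 kills the imaginary part. This upgrades estimates on
    real parts to the equation f(v) = ||v|| required of a support functional. *)
Lemma to_real_eq_rnorm z : rnorm z <= to_real z -> z = of_real k (rnorm z).
Proof.
move=> zz; have {zz} : to_real z = rnorm z by apply/le_anti; rewrite to_real_le_rnorm.
rewrite /rnorm /to_real /of_real; case: k z => [z|[a b]] //= ab.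
rewrite -ab; congr complex.Complex.
have : a ^+ 2 + b ^+ 2 = a ^+ 2.
  by rewrite [in RHS]ab sqr_sqrtr// addr_ge0// sqr_ge0.
by move/eqP; rewrite -subr_eq0 addrAC subrr add0r sqrf_eq0 => /eqP.
Qed.

(** Rotating by |z| / z turns bounds on the real part of a functional into bounds on its modulus. *)
Lemma phaseP z : exists2 u : scalars R k, rnorm u <= 1 & to_real (u * z) = rnorm z.
Proof.
have [->|z0] := eqVneq z 0.
  by exists 0; rewrite ?rnorm0// mulr0 -[in LHS](@of_real0 R k) of_realK.
exists (`|z| / z); last by rewrite divfK.
rewrite -(@ler_of_real R k) of_real_rnorm of_real1 normf_div normr_id.
by rewrite divff// normr_eq0.
Qed.

End RealPart.

(** * Young's inequality for conjugate exponents, and elementary limits as t tends to 0 *)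

Section PowerInequalities.
Context {R : realType}.
Implicit Types a b c r e p q : R.

Lemma le_of_le_addM a b c : 0 <= c ->
  (forall t, 0 < t -> t <= 1 -> a <= b + t * c) -> a <= b.
Proof.
move=> c0 abc; apply/ler_addgt0Pr => e e0.
(* Dividing by c + 1 gives t * c <= e and also covers c = 0. *)
have t0 : 0 < Num.min 1 (e / (c + 1)).
  by rewrite lt_min ltr01 divr_gt0// ltr_wpDl.
apply: le_trans (abc _ t0 _) _; first by rewrite ge_min lexx.
rewrite lerD2l (@le_trans _ _ (e / (c + 1) * c))//.
  by rewrite ler_wpM2r// ge_min lexx orbT.
by rewrite mulrAC ler_pdivrMr ?ltr_wpDl// ler_wpM2l ?ltW// ltrDl.
Qed.

Lemma powR_conjugateK p q c : 1 < p -> p^-1 + q^-1 = 1 -> 0 <= c ->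
  (c `^ (p - 1)) `^ q = c `^ p.
Proof.
move=> p1 pq c0; have p0 : p != 0 by rewrite gt_eqF// (lt_trans _ p1).
rewrite -powRrM; congr (_ `^ _).
have q1 := conjugate_ge1 p1 pq; have q0 : q != 0 by rewrite gt_eqF// (lt_le_trans _ q1).
(* Clearing denominators gives p + q = p * q, that is (p - 1) * q = p. *)
have : p * q * (p^-1 + q^-1) = p * q by rewrite pq mulr1.
by rewrite mulrDr mulrAC divff// mul1r mulfK//; lra.
Qed.

Lemma powR_predM p c : 1 < p -> 0 <= c -> c * c `^ (p - 1) = c `^ p.
Proof.
move=> p1 c0; rewrite -{1}[c]powRr1// -powRD; first by congr (_ `^ _); ring.
by rewrite addrC subrK gt_eqF// (lt_trans _ p1).
Qed.

Lemma young_pred p q a c : 1 < p -> p^-1 + q^-1 = 1 -> 0 <= a -> 0 <= c ->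
  a * c `^ (p - 1) <= a `^ p / p + c `^ p / q.
Proof.
move=> p1 pq a0 c0; have p0 : 0 < p by rewrite (lt_trans _ p1).
have q0 : 0 < q by rewrite (lt_le_trans _ (conjugate_ge1 p1 pq)).
have := conjugate_powR a0 (powR_ge0 c (p - 1)) p0 q0 pq.
by rewrite (powR_conjugateK p1 pq c0).
Qed.

(** Young's inequality with 1/q = 1 - 1/p, read as convexity: the graph of t^p / p lies above its
    tangent at c. *)
Lemma powR_tangent p a c : 1 < p -> 0 <= a -> 0 <= c ->
  (c `^ p - a `^ p) / p <= (c - a) * c `^ (p - 1).
Proof.
move=> p1 a0 c0.
have pq : p^-1 + (1 - p^-1)^-1^-1 = 1 by rewrite invrK addrC subrK.
have := young_pred p1 pq a0 c0; rewrite invrK mulrBl mulrBl powR_predM//.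
by lra.
Qed.

(** The arithmetic of [support_subgradient] with powers made opaque: n, n', np are ||x||,
    ||x||^(p-1), ||x||^p; wp, ap, cp are the p-th powers of ||w||, ||x_m||, ||x_m + h||; re is Re
    f_m(h). *)
Lemma young_subgradient p q (n re n' np wp ap cp : R) : p^-1 + q^-1 = 1 ->
  n * n' = np -> wp = np - ap + cp -> (n + re) * n' <= wp / p + np / q ->
  n' * re <= (cp - ap) / p.
Proof.
move=> pq <- ->; have -> : q^-1 = 1 - p^-1 by rewrite -pq addrC addKr.
by lra.
Qed.

Lemma root_le a b r : 0 < r -> 0 <= a -> 0 <= b -> a <= b `^ r -> a `^ r^-1 <= b.
Proof.
move=> r0 a0 b0 ab; rewrite -[leRHS]powRr1// -(mulfV (lt0r_neq0 r0)) powRrM.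
by rewrite ge0_ler_powR ?invr_ge0 ?nnegrE ?powR_ge0// ltW.
Qed.

Lemma le_root a b r : 0 < r -> 0 <= a -> 0 <= b -> a `^ r <= b -> a <= b `^ r^-1.
Proof.
move=> r0 a0 b0 ab; rewrite -[leLHS]powRr1// -(mulfV (lt0r_neq0 r0)) powRrM.
by rewrite ge0_ler_powR ?invr_ge0 ?nnegrE ?powR_ge0// ltW.
Qed.

Lemma rootK a r : 0 < r -> 0 <= a -> (a `^ r^-1) `^ r = a.
Proof. by move=> r0 a0; rewrite -powRrM mulVf ?gt_eqF// powRr1. Qed.

(** Taking r-th roots makes the dependence on t affine, so [le_of_le_addM] replaces continuity of
    the power. *)
Lemma powR_right_limit a b c r : 0 < r -> 0 <= a -> 0 <= b ->
  (forall t, 0 < t -> t <= 1 -> c <= (a + t * b) `^ r) -> c <= a `^ r.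
Proof.
move=> r0 a0 b0 H; case: (leP c 0) => [c0|/ltW c0].
  by rewrite (le_trans c0) ?powR_ge0.
suff : c `^ r^-1 <= a.
  move=> ca; rewrite -[leLHS](rootK r0 c0).
  by rewrite ge0_ler_powR ?nnegrE ?powR_ge0// ltW.
apply: (@le_of_le_addM _ _ b) => // t t0 t1.
by apply: root_le; rewrite ?H// addr_ge0// mulr_ge0// ltW.
Qed.

Lemma powR_left_limit a c r : 0 < r -> 0 <= a ->
  (forall t, 0 < t -> t <= 1 -> ((1 - t) * a) `^ r <= c) -> a `^ r <= c.
Proof.
move=> r0 a0 H.
(* The instance t = 1 bounds c below by a power, so c has an r-th root. *)
have c0 : 0 <= c by rewrite (le_trans _ (H 1 ltr01 (lexx _)))// powR_ge0.
rewrite -(rootK r0 c0) ge0_ler_powR ?nnegrE ?powR_ge0 ?(ltW r0)//.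
apply: (@le_of_le_addM _ _ a) => // t t0 t1.
rewrite addrC -lerBlDl -[X in X - _]mul1r -mulrBl.
by apply: le_root; rewrite ?H// mulr_ge0// subr_ge0.
Qed.

End PowerInequalities.

(** * Norms in the p-sum under a change of one coordinate *)

Section LpSumFacts.
Context {R : realType} {k : scalar_kind}.
Variables (p : R) (p1 : 1 <= p) (X : nat -> normedModType (scalars R k)).
Implicit Types x : lpsum p1 X.

Lemma lpsum_normE x :
  ((rnorm x `^ p)%:E = \sum_(n <oo) (rnorm (x n) `^ p)%:E)%E.
Proof.
have p0 : 0 < p by apply: lt_le_trans p1.
rewrite [RHS]psum_fin ?lpsumP// rnorm_lpsum /lpnorm -powRrM mulVf ?gt_eqF//.
by rewrite powRr1// fine_ge0// psum_ge0.
Qed.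

Lemma lpsum_single_subproof m (h : X m) :
  (\sum_(n <oo) (rnorm (dfwith (fun n => 0 : X n) m h n) `^ p)%:E < +oo)%E.
Proof.
have p0 : 0 < p by apply: lt_le_trans p1.
rewrite (nneseriesD1 (n := m))//; last by move=> i _; rewrite lee_fin powR_ge0.
rewrite eseries0 ?adde0 ?ltry// => i _ /andP[_ im].
by rewrite dfwithout 1?eq_sym// rnorm0 powR0// gt_eqF.
Qed.

Definition lpsum_single m (h : X m) : lpsum p1 X :=
  LpSum p1 (lpsum_single_subproof h).

Lemma lpsum_norm_add_single x m (h : X m) :
  rnorm (x + lpsum_single h) `^ p
  = rnorm x `^ p - rnorm (x m) `^ p + rnorm (x m + h) `^ p.
Proof.
have eqs : (\sum_(i <oo | i != m) (rnorm ((x + lpsum_single h) i) `^ p)%:E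
    = \sum_(i <oo | i != m) (rnorm (x i) `^ p)%:E)%E.
  by apply: eq_eseriesr => i im; rewrite /= dfwithout 1?eq_sym// addr0.
have split_sum (y : lpsum p1 X) : ((rnorm y `^ p)%:E = (rnorm (y m) `^ p)%:E +
    \sum_(i <oo | i != m) (rnorm (y i) `^ p)%:E)%E.
  by rewrite lpsum_normE (nneseriesD1 (n := m))// => *; rewrite lee_fin powR_ge0.
(* The common tail s is an extended real; the finite left-hand sides force it to be finite, so it
   cancels. *)
have cancel_tail (a b c d : R) (s : \bar R) :
    (a%:E = d%:E + s)%E -> (b%:E = c%:E + s)%E -> a = b - c + d.
  by case: s => [s| |]// [->] [->]; ring.
apply: cancel_tail (split_sum x).
rewrite split_sum eqs; congr ((rnorm _ `^ p)%:E + _)%E.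
by rewrite /= dfwithin.
Qed.

End LpSumFacts.

(** * The functional on the p-sum induced by a sequence of functionals *)

Section PairingFacts.
Context {R : realType} {k : scalar_kind}.
Variables (p q : R) (p1 : 1 <= p) (q1 : 1 <= q) (pq : p^-1 + q^-1 = 1).
Variable X : nat -> normedModType (scalars R k).
Variable f : lpsum q1 (fun n => dual (X n)).
Implicit Types x : lpsum p1 X.

Lemma support_functionalsP (V : normedModType (scalars R k)) (v : V) (g : dual V) :
  support_functionals v g <-> rnorm g = 1 /\ g v = of_real k (rnorm v).
Proof.
rewrite /support_functionals /= -!of_real_rnorm -(@of_real1 R k).
by split=> -[g1 ->]; split; rewrite ?g1//; apply: (can_inj (@of_realK R k)).
Qed.

(** Hölder's inequality applied to the sequences ||f_n|| and ||x_n||. *)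
Lemma rnorm_lpsum_functional x :
  rnorm (lpsum_functional p1 pq f x) <= rnorm f * rnorm x.
Proof.
have p0 : 0 < p by apply: lt_le_trans p1.
have q0 : 0 < q by apply: lt_le_trans q1.
have qp : q^-1 + p^-1 = 1 by rewrite addrC.
have fx : (\sum_(n <oo) (rnorm (f n (x n)))%:E <= (rnorm f * rnorm x)%:E)%E.
  rewrite !rnorm_lpsum; apply: le_trans (psum_hoelder q0 p0 qp
    (fun n => rnorm_ge0 (f n)) (fun n => rnorm_ge0 (x n)) (lpsumP f) (lpsumP x)).
  by apply: lee_nneseries => n *; rewrite lee_fin ?rnorm_ge0// rnorm_dual opnormP.
have fxy := le_lt_trans fx (ltry _).
rewrite (le_trans (scalars_series_le fxy))// -lee_fin fineK//.
by rewrite ge0_fin_numE// nneseries_ge0// => n *; rewrite lee_fin rnorm_ge0.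
Qed.

Lemma lpsum_functional_single m (h : X m) :
  lpsum_functional p1 pq f (lpsum_single p1 h) = f m h.
Proof.
(* The n-th partial sum stops before index n, so it is constant from m + 1 on. *)
apply: norm_lim_near_cst; exists m.+1 => // n mn.
rewrite /= /series /= (bigD1_seq m) ?mem_index_iota ?iota_uniq//= dfwithin big1 ?addr0//.
by move=> i im; rewrite dfwithout 1?eq_sym// linear0.
Qed.

(** The embedding [of_real] is additive and isometric, so it carries the real limit to the scalar
    one. *)
Lemma lpsum_functional_of_real x (u : nat -> R) (s : R) :
  (forall n, 0 <= u n) -> (forall n, f n (x n) = of_real k (u n)) ->
  (\sum_(n <oo) (u n)%:E = s%:E)%E ->
  lpsum_functional p1 pq f x = of_real k s.
Proof.
move=> u0 fu us; apply/cvg_lim => //.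
have us' : (series u @ \oo --> s)%classic.
  have : ((fun n => (\sum_(0 <= i < n) (u i)%:E)%E) @ \oo --> s%:E)%classic.
    rewrite -us; apply: is_cvg_nneseries => n _ _; by rewrite lee_fin.
  under eq_fun do rewrite sumEFin.
  by move/fine_cvgP => [].
have -> : series (fun n => f n (x n)) = (fun n => of_real k (series u n)).
  apply/funext => n; rewrite /series /= (big_morph (of_real k) (id1 := 0) (op1 := +%R)).
  - by apply: eq_bigr => i _; rewrite fu.
  - exact: of_realD.
  - exact: of_real0.
apply/cvgrPdist_lt => e e0.
(* A positive scalar is real, so the tolerance can be moved to R. *)
have ee : of_real k (to_real e) = e by rewrite to_realK// ltW.
have e0' : 0 < to_real e by rewrite -(@ltr_of_real R k) ee of_real0.
move/cvgrPdist_lt : us' => /(_ _ e0'); apply: filterS => n.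
rewrite -(@ltr_of_real R k) ee; apply: le_lt_trans.
suff -> : of_real k s - of_real k (series u n) = of_real k (s - series u n).
  by rewrite -of_real_rnorm rnorm_of_real.
by apply/eqP; rewrite subr_eq -of_realD subrK.
Qed.

End PairingFacts.

(** * The two implications between supporting x and supporting its coordinates *)

Section SupportFunctionals.
Context {R : realType} {k : scalar_kind}.
Variables (p q : R) (p_gt1 : 1 < p) (pq : p^-1 + q^-1 = 1).
Variable X : nat -> normedModType (scalars R k).
Variable x : lpsum (ltW p_gt1) X.
Variable f : lpsum (conjugate_ge1 p_gt1 pq) (fun n => dual (X n)).
Local Notation F := (lpsum_functional (ltW p_gt1) pq f).

(* [f m], scaled by [rnorm x `^ (p - 1)], is a subgradient of
   [h |-> rnorm h `^ p / p] at [x m]. *)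
Lemma support_subgradient m (h : X m) : support_functionals x F ->
  rnorm x `^ (p - 1) * to_real (f m h)
  <= (rnorm (x m + h) - rnorm (x m)) * rnorm (x m + h) `^ (p - 1).
Proof.
move=> /support_functionalsP[F1 Fx].
set w := x + lpsum_single (ltW p_gt1) h.
have Fw : rnorm x + to_real (f m h) <= rnorm w.
  have -> : rnorm x + to_real (f m h) = to_real (F w).
    have -> : F w = F x + F (lpsum_single (ltW p_gt1) h) by apply: linearD.
    by rewrite to_realD Fx of_realK lpsum_functional_single.
  rewrite (le_trans (to_real_le_rnorm _))// (le_trans (opnormP F w))//.
  by rewrite -rnorm_dual F1 mul1r.
apply: le_trans (powR_tangent p_gt1 (rnorm_ge0 _) (rnorm_ge0 _)).
have wx := young_pred p_gt1 pq (rnorm_ge0 w) (rnorm_ge0 x).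
move: (le_trans (ler_wpM2r (powR_ge0 (rnorm x) (p - 1)) Fw) wx).
exact: young_subgradient pq (powR_predM p_gt1 (rnorm_ge0 x)) (lpsum_norm_add_single x h).
Qed.

(** Use the subgradient bound at h = t u v, with u the phase making u f_m(v) = |f_m(v)|; divide by t
    and let t tend to 0. *)
Lemma support_coordinate_le m (v : X m) : support_functionals x F ->
  rnorm x `^ (p - 1) * rnorm (f m v) <= rnorm (x m) `^ (p - 1) * rnorm v.
Proof.
move=> Fx; have [->|v0] := eqVneq v 0; first by rewrite linear0 !rnorm0 !mulr0.
have nv : 0 < rnorm v by rewrite rnorm_gt0.
have [u u1 uv] := phaseP (f m v).
rewrite -ler_pdivrMr//.
apply: (@powR_right_limit _ _ (rnorm v)); rewrite ?subr_gt0 ?rnorm_ge0// => t t0 t1.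
rewrite ler_pdivrMr// -(ler_pM2l t0).
have := support_subgradient (of_real k t * u *: v) Fx.
rewrite linearZ /= -mulrA to_real_of_realM uv mulrCA => /le_trans; apply.
have tuv : rnorm (of_real k t * u *: v) <= t * rnorm v.
  rewrite rnormZ rnormM rnorm_of_real ger0_norm ?(ltW t0)// -mulrA ler_wpM2l ?(ltW t0)//.
  by rewrite ler_piMl ?rnorm_ge0.
have xtuv := le_trans (ler_rnormD (x m) (of_real k t * u *: v)) (lerD (lexx _) tuv).
rewrite [X in _ <= t * X]mulrC mulrA.
apply: (@le_trans _ _ (t * rnorm v * rnorm (x m + of_real k t * u *: v) `^ (p - 1))).
  by rewrite ler_wpM2r ?powR_ge0// lerBlDl.
rewrite ler_wpM2l ?mulr_ge0 ?rnorm_ge0 ?(ltW t0)//.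
rewrite ge0_ler_powR ?nnegrE ?rnorm_ge0 ?subr_ge0 ?(ltW p_gt1)//.
by rewrite addr_ge0 ?mulr_ge0 ?rnorm_ge0 ?(ltW t0).
Qed.

(** Here h = - t x_m, so x_m + h = (1 - t) x_m; the factor - t on both sides reverses the inequality
    into a lower bound. *)
Lemma support_coordinate_ge m : support_functionals x F ->
  rnorm (x m) `^ (p - 1) * rnorm (x m) <= rnorm x `^ (p - 1) * to_real (f m (x m)).
Proof.
move=> Fx; have [->|v0] := eqVneq (x m) 0.
  by rewrite linear0 !rnorm0 mulr0 -(@of_real0 R k) of_realK mulr0.
have nv : 0 < rnorm (x m).
  by rewrite rnorm_gt0.
rewrite -ler_pdivlMr//.
apply: powR_left_limit; rewrite ?subr_gt0 ?rnorm_ge0// => t t0 t1.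
rewrite ler_pdivlMr// -(ler_pM2l t0).
have := support_subgradient (of_real k (- t) *: x m) Fx.
have -> : x m + of_real k (- t) *: x m = of_real k (1 - t) *: x m.
  by rewrite of_realD of_real1 scalerDl scale1r.
rewrite linearZ /= to_real_of_realM rnormZ rnorm_of_real ger0_norm ?subr_ge0//.
by lra.
Qed.

Lemma support_coordinates n : x != 0 -> support_functionals x F ->
  (x n != 0 -> support_functionals (x n)
     (of_real k (rnorm x `^ (p - 1) / rnorm (x n) `^ (p - 1)) *: f n)) /\
  (x n = 0 -> f n = 0).
Proof.
move=> x0 Fx.
have Npos : 0 < rnorm x `^ (p - 1).
  by rewrite powR_gt0// rnorm_gt0.
split=> [xn0|xn0]; last first.
  (* As p - 1 is non-zero, 0^(p-1) = 0 and the upper bound on |f_n(v)| collapses. *)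
  apply: dualP => v; apply: rnorm_eq0; apply/le_anti; rewrite rnorm_ge0 andbT.
  have := support_coordinate_le v Fx.
  by rewrite xn0 rnorm0 powR0 ?subr_eq0 ?gt_eqF// mul0r pmulr_rle0.
have nx : 0 < rnorm (x n).
  by rewrite rnorm_gt0.
have npos : 0 < rnorm (x n) `^ (p - 1) by rewrite powR_gt0.
set c := rnorm x `^ (p - 1) / rnorm (x n) `^ (p - 1).
have c0 : 0 <= c by rewrite divr_ge0 ?powR_ge0.
set g : dual (X n) := of_real k c *: f n.
have gE v : g v = of_real k c * f n v by [].
have gle v : rnorm (g v) <= rnorm v.
  rewrite gE rnormM rnorm_of_real ger0_norm// /c mulrAC ler_pdivrMr// [leRHS]mulrC.
  exact: support_coordinate_le.
have gge : rnorm (x n) <= to_real (g (x n)).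
  rewrite gE to_real_of_realM /c mulrAC ler_pdivlMr// mulrC.
  exact: support_coordinate_ge.
have gx : rnorm (g (x n)) = rnorm (x n).
  by apply/le_anti; rewrite gle (le_trans gge)// to_real_le_rnorm.
apply/support_functionalsP; split; last first.
  by rewrite -gx; apply: to_real_eq_rnorm; rewrite gx.
apply/le_anti; rewrite rnorm_dual; apply/andP; split.
  by apply: opnorm_le => v v1; rewrite (le_trans (gle v)).
(* The norm 1 is attained at x_n, since |g(x_n)| = ||x_n||. *)
by rewrite -(ler_pM2r nx) mul1r -[leLHS]gx opnormP.
Qed.

Lemma coordinates_support : x != 0 ->
  (forall n, (x n != 0 -> support_functionals (x n)
      (of_real k (rnorm x `^ (p - 1) / rnorm (x n) `^ (p - 1)) *: f n)) /\
    (x n = 0 -> f n = 0)) ->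
  support_functionals x F.
Proof.
move=> x0 H.
have nx : 0 < rnorm x.
  by rewrite rnorm_gt0.
have Npos : 0 < rnorm x `^ (p - 1) by rewrite powR_gt0.
have q1 : 1 <= q := conjugate_ge1 p_gt1 pq.
have p0 : 0 < p by rewrite (lt_trans _ p_gt1).
have q0 : 0 < q by rewrite (lt_le_trans _ q1).
(* With s_n = ||x_n|| / ||x||, both ||f_n||^q and f_n(x_n) / ||x|| equal s_n^p, and the s_n^p sum to
   1. Vanishing coordinates fit the same formulas. *)
have fE n : rnorm (f n) = ((rnorm x)^-1 * rnorm (x n)) `^ (p - 1) /\
    f n (x n) = of_real k (rnorm x * ((rnorm x)^-1 * rnorm (x n)) `^ p).
  have [Hn Hn0] := H n; have [xn0|xn0] := eqVneq (x n) 0.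
    by rewrite Hn0// xn0 !rnorm0 mulr0 !powR0 ?mulr0 ?of_real0 ?subr_eq0 ?gt_eqF//.
  have nxn : 0 < rnorm (x n).
    by rewrite rnorm_gt0.
  have npos : 0 < rnorm (x n) `^ (p - 1) by rewrite powR_gt0.
  set s := (rnorm x)^-1 * rnorm (x n).
  have s0 : 0 <= s by rewrite mulr_ge0 ?invr_ge0 ?rnorm_ge0.
  have xnE : rnorm (x n) = rnorm x * s by rewrite mulVKf// gt_eqF.
  have cs : rnorm x `^ (p - 1) / rnorm (x n) `^ (p - 1) * s `^ (p - 1) = 1.
    by rewrite mulrAC -powRM ?rnorm_ge0// -xnE divff// gt_eqF.
  have /support_functionalsP[] := Hn xn0.
  have := divr_ge0 (powR_ge0 (rnorm x) (p - 1)) (powR_ge0 (rnorm (x n)) (p - 1)).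
  move: (rnorm x `^ (p - 1) / _) cs => c cs c0.
  have sc : of_real k (s `^ (p - 1)) * of_real k c = 1.
    by rewrite -of_realM mulrC cs of_real1.
  rewrite rnormZ rnorm_of_real ger0_norm// => g1 gx; split.
    have -> : rnorm (f n) = c * s `^ (p - 1) * rnorm (f n) by rewrite cs mul1r.
    by rewrite mulrAC g1 mul1r.
  rewrite -[LHS]mul1r -sc -mulrA [X in _ * X]gx -of_realM xnE -(powR_predM p_gt1 s0).
  by congr of_real; ring.
have unit_sum : (\sum_(n <oo) (((rnorm x)^-1 * rnorm (x n)) `^ p)%:E = 1)%E.
  rewrite psumZ ?invr_ge0 ?rnorm_ge0//; last by move=> n; apply: rnorm_ge0.
  by rewrite -lpsum_normE -EFinM -powRM ?invr_ge0 ?rnorm_ge0// mulVf ?gt_eqF// powR1.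
have f1 : rnorm f = 1.
  rewrite rnorm_lpsum /lpnorm (_ : (\sum_(n <oo) _)%E = 1%E) ?powR1//.
  rewrite -unit_sum; apply: eq_eseriesr => n _.
  by rewrite (fE n).1 (powR_conjugateK p_gt1 pq)// mulr_ge0 ?invr_ge0 ?rnorm_ge0.
have Fx : F x = of_real k (rnorm x).
  apply: (@lpsum_functional_of_real _ _ _ _ _ _ _ _ _ _
    (fun n => rnorm x * ((rnorm x)^-1 * rnorm (x n)) `^ p)).
  - by move=> n; rewrite mulr_ge0 ?rnorm_ge0 ?powR_ge0.
  - by move=> n; rewrite (fE n).2.
  - under eq_eseriesr do rewrite EFinM.
    rewrite nneseriesZl ?unit_sum ?mule1// => *; by rewrite lee_fin powR_ge0.
apply/support_functionalsP; split=> //.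
apply/le_anti; rewrite rnorm_dual; apply/andP; split.
  apply: opnorm_le => v v1.
  by rewrite (le_trans (rnorm_lpsum_functional pq f v))// f1 mul1r.
(* The lower bound ||F|| >= 1 comes from evaluating F at x itself. *)
rewrite -(ler_pM2r nx) mul1r.
have := opnormP F x.
by rewrite Fx rnorm_of_real ger0_norm ?rnorm_ge0.
Qed.

End SupportFunctionals.

Unset Implicit Arguments.
Set Strict Implicit.

Theorem theorem9 (R : realType) (k : scalar_kind)
    (X : nat -> normedModType (scalars R k))
    (X_nontrivial : forall n : nat, exists v : X n, v != 0)
    (p q : R) (p_gt1 : 1 < p) (pq : p^-1 + q^-1 = 1)
    (x : lpsum (ltW p_gt1) X) (x_neq0 : x != 0)
    (f : lpsum (conjugate_ge1 p_gt1 pq) (fun n => dual (X n))) :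
  support_functionals x (lpsum_functional (ltW p_gt1) pq f) <->
  (forall n : nat,
     (x n != 0 ->
        support_functionals (x n)
          (of_real k (rnorm x `^ (p - 1) / rnorm (x n) `^ (p - 1)) *: f n)) /\
     (x n = 0 -> f n = 0)).
Proof.
split=> [Fx n|]; first exact: support_coordinates.
exact: coordinates_support.
Qed.
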